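(* Let $\mathfrak{g}$ be a real vector space of dimension $n$ and let $\mu\in\Lambda^2\mathfrak{g}^*\otimes\mathfrak{g}$ be a $k$-step nilpotent Lie algebra structure on $\mathfrak{g}$. If $H^2_{k\text{-}nil}(\mathfrak{g},\mathfrak{g})=0$, then there are a neighborhood $W$ of $\mu$ in $\Lambda^2\mathfrak{g}^*\otimes\mathfrak{g}$ and a smooth map $H:W\to GL(\mathfrak{g})$ such that $H(\lambda)\cdot\mu=\lambda$ for every $\lambda\in W\cap\mathcal{N}_{n,k}$. Hence $(\mathfrak{g},\mu)$ is rigid in $\mathcal{N}_{n,k}$.
   Context: All Lie algebras are finite dimensional. For $\sigma\in\Lambda^2\mathfrak{g}^*\otimes\mathfrak{g}$ (alternating bilinear maps $\mathfrak{g}\times\mathfrak{g}\to\mathfrak{g}$) put $J(\sigma)(x,y,z)=\sum_{cyclic}\sigma(\sigma(x,y),z)$, and define $N_k(\sigma)\in(\mathfrak{g}^* )^{\otimes(k+1)}\otimes\mathfrak{g}$ inductively by $N_1(\sigma)(x_1,x_2)=\sigma(x_1,x_2)$ and $N_k(\sigma)(x_1,\dots,x_{k+1})=\sigma(N_{k-1}(\sigma)(x_1,\dots,x_k),x_{k+1})$. Let $\mathcal{N}_{n,k}=\{\sigma\in\Lambda^2\mathfrak{g}^*\otimes\mathfrak{g}: J(\sigma)=0,\ N_k(\sigma)=0\}$, the variety of (at most) $k$-step nilpotent Lie algebra structures on $\mathfrak{g}$. The group $GL(\mathfrak{g})$ acts by $(g\cdot\mu)(x,y)=g(\mu(g^{-1}x,g^{-1}y))$.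 A structure $\mu\in\mathcal{N}_{n,k}$ is rigid in $\mathcal{N}_{n,k}$ if its $GL(\mathfrak{g})$-orbit is open in $\mathcal{N}_{n,k}$ (equivalently in the metric or Zariski topology). Let $d^1_\mu:\mathfrak{g}^*\otimes\mathfrak{g}\to\Lambda^2\mathfrak{g}^*\otimes\mathfrak{g}$ and $d^2_\mu:\Lambda^2\mathfrak{g}^*\otimes\mathfrak{g}\to\Lambda^3\mathfrak{g}^*\otimes\mathfrak{g}$ be the Chevalley–Eilenberg differentials of $(\mathfrak{g},\mu)$ with coefficients in the adjoint representation, and let $dN_k|_\mu$ be the differential at $\mu$ of the polynomial map $N_k:\Lambda^2\mathfrak{g}^*\otimes\mathfrak{g}\to(\mathfrak{g}^* )^{\otimes(k+1)}\otimes\mathfrak{g}$. One has $\mathrm{Im}(d^1_\mu)\subset\mathrm{Ker}(d^2_\mu)\cap\mathrm{Ker}(dN_k|_\mu)$, and one defines $$H^2_{k\text{-}nil}(\mathfrak{g},\mathfrak{g})=\frac{\mathrm{Ker}(d^2_\mu)\cap\mathrm{Ker}(dN_k|_\mu)}{\mathrm{Im}(d^1_\mu)}.$$ *)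

(* Defs.v *)
From HB Require Import structures.
From mathcomp Require Import all_boot all_order all_algebra.
From mathcomp Require Import all_classical all_reals all_analysis.

Set Implicit Arguments.
Unset Strict Implicit.
Unset Printing Implicit Defensive.

Import Order.TTheory GRing.Theory Num.Theory.
Import numFieldNormedType.Exports.

Local Open Scope classical_set_scope.
Local Open Scope ring_scope.

(* The alias [fdnormed E] carries the sup norm of coordinates, hence the
   canonical topology of the finite-dimensional space E. *)
Definition fdnormed (R : realType) (E : vectType R) : Type := E.

Section FdNormed.
Import passmx.
Variables (R : realType) (E : vectType R).

HB.instance Definition _ := Vector.on (fdnormed E).

Definition fdnorm (x : fdnormed E) : R := `|rVof (vbasis {:E}) x|.

Fact fdnormD x y : fdnorm (x + y) <= fdnorm x + fdnorm y.
Proof.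
rewrite /fdnorm [X in `|X|](linearD (rVof (vbasis {:E})) (x : E) y).
exact: ler_normD.
Qed.

Fact fdnormZ (a : R) x : fdnorm (a *: x) = `|a| * fdnorm x.
Proof.
rewrite /fdnorm [X in `|X|](linearZZ (rVof (vbasis {:E})) a (x : E)).
exact: normrZ.
Qed.

Fact fdnorm_eq0 x : fdnorm x = 0 -> x = 0.
Proof.
move=> /normr0_eq0 x0; apply: (can_inj (rVofK (vbasisP {:E}))).
by rewrite x0 linear0.
Qed.

HB.instance Definition _ :=
  Lmodule_isNormed.Build R (fdnormed E) fdnormD fdnormZ fdnorm_eq0.

End FdNormed.

Section Smooth.
Variables (R : realType) (E F : normedModType R).

(* For E of finite dimension, continuity (or C^n regularity) of the
   differential x |-> 'd f x is the same as that of x |-> 'd f x v for every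
   fixed v.  Since U is meant to be open, the values of f outside U are
   irrelevant. *)
Fixpoint Cn_on (n : nat) (U : set E) (f : E -> F) : Prop :=
  if n is n'.+1 then
    (forall x, U x -> differentiable f x) /\
    (forall v : E, Cn_on n' U (fun x => 'd f x v))
  else forall x, U x -> {for x, continuous f}.

Definition smooth_on (U : set E) (f : E -> F) : Prop :=
  forall n, Cn_on n U f.

End Smooth.

Section Alternating.
Variables (R : realType) (V : vectType R).
Implicit Types s : 'Hom(V, 'Hom(V, V)).

Lemma linfunE_of_linear (U W : vectType R) (f : U -> W) :
  linear f -> linfun f =1 f.
Proof.
move=> lf x.
pose f' : {linear U -> W} := HB.pack f (GRing.isLinear.Build R U W _ f lf).
exact: (lfunE f').
Qed.

Lemma lfun_curry_linear (f : V -> V -> V) :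
  (forall x, linear (f x)) -> (forall y, linear (f ^~ y)) ->
  forall x y, linfun (fun x => linfun (f x)) x y = f x y.
Proof.
move=> fr fl x y; have lf : linear (fun x => linfun (f x)).
  move=> a u v; apply/lfunP => w.
  by rewrite !(add_lfunE, scale_lfunE) !linfunE_of_linear// fl.
by rewrite (linfunE_of_linear lf) linfunE_of_linear.
Qed.

Definition flip s : 'Hom(V, 'Hom(V, V)) :=
  linfun (fun x => linfun (fun y => s y x)).

Lemma flipE s x y : flip s x y = s y x.
Proof.
rewrite /flip (@lfun_curry_linear (fun x y => s y x))//.
- by move=> u a v w; rewrite linearP add_lfunE scale_lfunE.
- by move=> u a v w; rewrite linearP.
Qed.

Lemma flip_is_linear : linear (fun s => s + flip s).
Proof.
move=> a s t; apply/lfunP => x; apply/lfunP => y.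
rewrite !(add_lfunE, scale_lfunE, flipE).
by rewrite scalerDr addrACA.
Qed.

(* The condition s + flip s = 0 is equivalent to s x x = 0 for all x, see
   alt_spaceP. *)
Definition alt_space : {vspace 'Hom(V, 'Hom(V, V))} :=
  lker (linfun (fun s => s + flip s)).

Lemma alt_spaceP s : s \in alt_space <-> forall x, s x x = 0.
Proof.
rewrite memv_ker linfunE_of_linear; last exact: flip_is_linear.
split=> [/eqP h x|h].
  have : (s + flip s) x x = 0 by rewrite h !lfunE.
  rewrite !add_lfunE flipE -mulr2n -scaler_nat => /eqP.
  by rewrite scaler_eq0 pnatr_eq0/= => /eqP.
apply/eqP/lfunP => x; apply/lfunP => y; rewrite !(add_lfunE, zero_lfunE) flipE.
have := h (x + y).
by rewrite !linearD/= !add_lfunE !h add0r addr0 addrC.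
Qed.

(* Lambda^2 g^* (x) g *)
Definition alt2 : Type := fdnormed (subvs_of alt_space).

HB.instance Definition _ := Vector.on alt2.
HB.instance Definition _ := NormedModule.on alt2.

Definition alt2_fun (s : alt2) (x y : V) : V := vsval s x y.
Coercion alt2_fun : alt2 >-> Funclass.

(* Junk unless f is bilinear and alternating. *)
Definition mk_alt2 (f : V -> V -> V) : alt2 :=
  vsproj alt_space (linfun (fun x => linfun (f x))).

Lemma mk_alt2E (f : V -> V -> V) :
  (forall x, linear (f x)) -> (forall y, linear (f ^~ y)) ->
  (forall x, f x x = 0) -> forall x y, mk_alt2 f x y = f x y.
Proof.
move=> fr fl f0 x y; rewrite /alt2_fun vsprojK ?lfun_curry_linear//.
by apply/alt_spaceP => z; rewrite lfun_curry_linear.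
Qed.

Lemma alt2_linearr (s : alt2) x : linear (s x).
Proof. by move=> a u v; rewrite /alt2_fun linearP. Qed.

Lemma alt2_linearl (s : alt2) y : linear (s ^~ y).
Proof.
by move=> a u v; rewrite /alt2_fun linearP !add_lfunE scale_lfunE.
Qed.

Lemma alt2xx (s : alt2) x : s x x = 0.
Proof. by have /alt_spaceP := subvsP s; apply. Qed.

Lemma alt2C (s : alt2) x y : s x y = - s y x.
Proof.
apply/eqP; rewrite -addr_eq0 /alt2_fun.
have /eqP := alt2xx s (x + y); rewrite /alt2_fun !linearD/= !add_lfunE.
have := alt2xx s x; have := alt2xx s y; rewrite /alt2_fun => -> ->.
by rewrite add0r addr0 addrC.
Qed.

Lemma alt20 x y : (0 : alt2) x y = 0.
Proof. by rewrite /alt2_fun linear0 !zero_lfunE. Qed.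

Lemma alt2B (s t : alt2) x y : (s - t : alt2) x y = s x y - t x y.
Proof. by rewrite /alt2_fun linearB !(add_lfunE, opp_lfunE). Qed.

Lemma alt2x0 (s : alt2) x : s x 0 = 0.
Proof. by rewrite /alt2_fun linear0. Qed.

Lemma alt2Br (s : alt2) x u v : s x (u - v) = s x u - s x v.
Proof. by rewrite /alt2_fun linearB. Qed.

Lemma alt2P (s t : alt2) : (forall x y, s x y = t x y) -> s = t.
Proof.
by move=> st; apply: subvs_inj; apply/lfunP => x; apply/lfunP => y; exact: st.
Qed.

Definition jacobiator (s : alt2) (x y z : V) : V :=
  s (s x y) z + s (s y z) x + s (s z x) y.

(* N_k(s)(x_1, ..., x_{k+1}) = s(...s(s(x_1, x_2), x_3)..., x_{k+1}) *)
Definition Nk (k : nat) (s : alt2) (x : k.+1.-tuple V) : V :=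
  foldl s (thead x) (behead x).

Lemma Nk1 (s : alt2) (x y : V) : Nk s [tuple x; y] = s x y.
Proof. by []. Qed.

Lemma NkS (k : nat) (s : alt2) (x : k.+1.-tuple V) (y : V) :
  Nk s [tuple of rcons x y] = s (Nk s x) y.
Proof.
by case/tupleP: x => x0 x; rewrite /Nk !theadE/= foldl_rcons.
Qed.

Definition nilp_var (k : nat) : set alt2 :=
  [set s | (forall x y z, jacobiator s x y z = 0) /\
           (forall x : k.+1.-tuple V, Nk s x = 0)].

(* For g in GL, (g^-1)%VF is its two-sided inverse. *)
Definition GL : set 'End(V) := [set g | lker g == 0%VS].

Definition act (g : 'End(V)) (m : alt2) : alt2 :=
  mk_alt2 (fun x y => g (m ((g^-1)%VF x) ((g^-1)%VF y))).

Lemma actE g m x y : act g m x y = g (m ((g^-1)%VF x) ((g^-1)%VF y)).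
Proof.
rewrite /act mk_alt2E// => [u a v w|u a v w|u].
- by rewrite linearP alt2_linearr linearP.
- by rewrite linearP alt2_linearl linearP.
- by rewrite alt2xx linear0.
Qed.

Definition GL_orbit (m : alt2) : set alt2 := [set act g m | g in GL].

Definition rigid (k : nat) (m : alt2) : Prop :=
  nilp_var k m /\
  exists2 U : set alt2, open U & GL_orbit m = U `&` nilp_var k.

Definition d1 (m : alt2) (f : 'End(V)) : alt2 :=
  mk_alt2 (fun x y => m x (f y) - m y (f x) - f (m x y)).

Lemma d1E m f x y : d1 m f x y = m x (f y) - m y (f x) - f (m x y).
Proof.
have addA6 (a b c d e h : V) : a + b - (c + d) - (e + h) = a - c - e + (b - d - h).
  by rewrite !opprD !addrA; rewrite (AC (6%AC) (1*3*5*2*4*6)%AC).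
rewrite /d1 mk_alt2E// => [u a v w|u a v w|u].
- rewrite (linearP f) (alt2_linearr m) (alt2_linearl m) (alt2_linearr m).
  by rewrite (linearP f) addA6 !scalerBr.
- rewrite (linearP f) (alt2_linearr m) (alt2_linearl m) (alt2_linearl m).
  by rewrite (linearP f) addA6 !scalerBr.
- by rewrite subrr alt2xx linear0 subr0.
Qed.

Definition d2 (m s : alt2) (x y z : V) : V :=
  m x (s y z) - m y (s x z) + m z (s x y)
  - s (m x y) z + s (m x z) y - s (m y z) x.

(* The differential of N_k at m, in the direction s, evaluated at x. *)
Definition dNk (k : nat) (m s : alt2) (x : k.+1.-tuple V) : V :=
  'd (fun t : alt2 => Nk t x : fdnormed V) m s.

Definition Z2nil (k : nat) (m : alt2) : set alt2 :=
  [set s | (forall x y z, d2 m s x y z = 0) /\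
           (forall x : k.+1.-tuple V, dNk m s x = 0)].

Definition B2 (m : alt2) : set alt2 := range (d1 m).

(* The set of cosets s + Im d1, for s in Ker d2 /\ Ker dN_k; its zero element
   is the coset Im d1. *)
Definition H2nil (k : nat) (m : alt2) : set (set alt2) :=
  [set [set s + b | b in B2 m] | s in Z2nil k m].

Lemma B20 m : B2 m 0.
Proof.
exists 0 => //; apply: alt2P => x y.
by rewrite d1E alt20 !zero_lfunE !alt2x0 !subr0.
Qed.

Lemma B2B m (s t : alt2) : B2 m s -> B2 m t -> B2 m (s - t).
Proof.
move=> [f _ <-] [g _ <-]; exists (f - g) => //; apply: alt2P => x y.
rewrite alt2B !d1E !(add_lfunE, opp_lfunE) !alt2Br.
move: (m x (f y)) (m x (g y)) (m y (f x)) (m y (g x)) (f (m x y)) (g (m x y)).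
by move=> a b c d e h; rewrite !opprD !opprK !addrA (AC 6 (1*3*5*2*4*6)).
Qed.

Lemma Z20 k m : Z2nil k m 0.
Proof.
split=> [x y z|x]; last by rewrite /dNk linear0.
by rewrite /d2 !alt20 !alt2x0 !subr0 !addr0.
Qed.

Lemma H2nil_eq0P k m : H2nil k m = [set B2 m] <-> Z2nil k m `<=` B2 m.
Proof.
split=> [H0 s Zs|ZB].
  have : H2nil k m [set s + b | b in B2 m] by exists s.
  rewrite H0 /= => <-; exists 0; [exact: B20|exact: addr0].
apply/seteqP; split=> [_ [s Zs <-]|_ ->] /=; last first.
  exists 0; first exact: Z20.
  apply/seteqP; split=> [_ [b Bb <-]|b Bb]; first by rewrite add0r.
  by exists b; rewrite ?add0r.
have Bs := ZB s Zs; apply/seteqP; split=> [_ [b Bb <-]|b Bb].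
  rewrite -[b]opprK; apply: B2B => //; rewrite -sub0r.
  by apply: B2B => //; exact: B20.
by exists (b - s); [exact: B2B|rewrite addrC subrK].
Qed.

End Alternating.

Arguments GL {R} V.
Arguments nilp_var {R} V k.

(* Main.v *)
Require Import Defs.
From HB Require Import structures.
From mathcomp Require Import all_boot all_order all_algebra.
From mathcomp Require Import all_classical all_reals all_analysis.
From mathcomp Require Import ring lra.

Import Order.TTheory GRing.Theory Num.Theory.
Import numFieldNormedType.Exports.

Local Open Scope classical_set_scope.
Local Open Scope ring_scope.

Set Implicit Arguments.
Unset Strict Implicit.
Unset Printing Implicit Defensive.

(** The orbit of mu is parametrized near mu by an implicit function, and the
    vanishing of the cohomology forces every nearby structure onto it.

    Let D = d1 mu, and let P be a linear projection of Lambda^2 g^* (x) g onto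
    Im D, with a linear K such that D K = P.  A map g in GL carries mu to la
    iff the defect g mu(x, y) - la(g x, g y) vanishes.  The defect is
    polynomial in (g, la), no inverse of g occurs in it, and its derivative
    in g at (1, mu) is - D.  Hence the equation
    g = 1 + K (D (g - 1) + defect(g, la)), quadratic in g, has at (1, mu) a
    right-hand side with zero derivative in g.  It is solved near mu by
    contraction, with g = h(la) depending smoothly on la
    ([quadratic_implicit_function]); applying D to it shows that the defect
    of (h(la), la) is killed by P ([slice_exists]).  So h(la) moves mu to la
    up to a defect transverse to Im D.

    It remains to see that this defect is zero when la is a nilpotent Lie
    structure.  Put nu = g^-1 . la with g = h(la).  Then nu is again in the
    variety, it tends to mu with la, and the defect is - g (nu - mu), so that
    P (g (nu - mu)) = 0.  If such nu <> mu accumulated at mu, a limit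
    direction e of nu - mu, of norm 1, would satisfy P e = 0; as mu and nu
    are zeros of the Jacobiator and of N_k, it would also lie in Ker d2 and
    in Ker dN_k.  By hypothesis this makes e a coboundary, whence
    e = P e = 0, a contradiction.  The compactness of the unit sphere turns
    this into [nilp_var_locally_unique].  Only first derivatives at mu
    itself are involved, because mu rather than la is the base point of the
    comparison.

    The smoothness of h is obtained without composing smooth maps: a class of
    functions that is closed under directional derivatives consists of smooth
    functions ([smooth_on_closed_class]), and the derivatives of h stay in
    the class generated by h, constants, sums, the quadratic term and the
    resolvent of the linearized equation ([branch_poly]).

    Finally the orbit is the trace on the variety of the union of the
    GL-translates of the neighborhood of mu so obtained, which is open. *)

(** * Topology of finite-dimensional spaces *)

Section FiniteDimensionalTopology.
Import passmx.
Variables (R : realType).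
Implicit Types (A B C : vectType R) (W : normedModType R).

Lemma fd_norm_coord A (x : fdnormed A) i :
  `|coord (vbasis {:A}) i x| <= `|x|.
Proof.
rewrite [leRHS](_ : _ = `|rVof (vbasis {:A}) x|)// coord_rVof.
rewrite [leRHS]/Num.norm/= mx_normrE.
exact: (le_bigmax _ (fun i => `|rVof (vbasis {:A}) x i.1 i.2|) (ord0, i)).
Qed.

Lemma fd_coord_sum A (x : A) :
  x = \sum_(i < \dim {:A}) coord (vbasis {:A}) i x *: (vbasis {:A})`_i.
Proof. by apply: coord_vbasis; rewrite memvf. Qed.

Lemma fd_linear_bounded A W (f : {linear fdnormed A -> W}) :
  exists2 M, 0 < M & forall x, `|f x| <= M * `|x|.
Proof.
exists (1 + \sum_(i < \dim {:A}) `|f (vbasis {:A})`_i|) => [|x].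
  by rewrite ltr_pwDl// sumr_ge0.
rewrite [in leLHS](@fd_coord_sum A x) linear_sum mulrDl mul1r ler_wpDl//.
rewrite (le_trans (ler_norm_sum _ _ _))// mulr_suml ler_sum// => i _.
by rewrite linearZZ normrZ [leRHS]mulrC ler_wpM2r// fd_norm_coord.
Qed.

Lemma fd_linear_continuous A W (f : {linear fdnormed A -> W}) : continuous f.
Proof.
apply: bounded_linear_continuous; apply/linear_boundedP.
have [M M0 fM] := fd_linear_bounded f.
exists M; split; first exact: num_real.
by move=> r Mr x; rewrite (le_trans (fM _))// ler_wpM2r// ltW.
Qed.

Lemma fd_linear_cvg A W (f : A -> W) (T : Type)
    (F : set_system T) {FF : Filter F}
    (u : T -> fdnormed A) (a : fdnormed A) : linear f ->
  u @ F --> a -> f (u t) @[t --> F] --> f a.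
Proof.
move=> lf ua.
pose f' : {linear fdnormed A -> W} :=
  HB.pack (f : fdnormed A -> W) (GRing.isLinear.Build R (fdnormed A) W _ f lf).
exact: (cvg_comp _ _ ua (@fd_linear_continuous A W f' a)).
Qed.

Lemma fd_complete A (F : set_system (fdnormed A)) (FF : ProperFilter F) :
  cauchy F -> cvg F.
Proof.
move=> /cauchyP cF; pose co (x : fdnormed A) := rVof (vbasis {:A}) (x : A).
have coN x y : `|co x - co y| = `|x - y|.
  by rewrite -[co x - co y](linearB (rVof (vbasis {:A})) (x : A) y).
have /cauchy_cvg/cvg_ex[/= l Fl] : cauchy (co @ F).
  apply/cauchyP => e /cF[x Fx]; exists (co x).
  suff : F [set y | ball (co x) e (co y)] by [].
  by apply: filterS Fx => y; rewrite -!ball_normE/= coN.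
apply/cvg_ex; exists (vecof (vbasis {:A}) l : fdnormed A).
apply/cvgrPdist_lt => e e0; have /cvgrPdist_lt/(_ e e0) := Fl.
by apply: filterS => y/=; rewrite -coN /co vecofK// vbasisP.
Qed.

HB.instance Definition _ A := Uniform_isComplete.Build (fdnormed A)
  (@fd_complete A).

Lemma sumf_cvg W (T : Type) (F : set_system T) {FF : Filter F} n
    (u : 'I_n -> T -> W) (a : 'I_n -> W) :
  (forall i, u i @ F --> a i) ->
  \sum_(i < n) u i t @[t --> F] --> \sum_(i < n) a i.
Proof.
move=> ua; apply: cvg_big => //; exact: add_continuous.
Qed.

(** Expanding the argument in a basis makes f x a sum of products of continuous
    functions of f and x, so no norm estimate is needed. *)
Lemma cvg_lfun A B (T : Type) (F : set_system T) {FF : Filter F}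
    (f : T -> fdnormed 'Hom(A, B)) (f0 : fdnormed 'Hom(A, B))
    (g : T -> fdnormed A) (g0 : fdnormed A) :
  f @ F --> f0 -> g @ F --> g0 ->
  (f t (g t) : fdnormed B) @[t --> F] --> (f0 g0 : fdnormed B).
Proof.
move=> ff gg.
pose G (h : 'Hom(A, B)) (x : A) : fdnormed B :=
  \sum_(i < \dim {:A}) coord (vbasis {:A}) i x *:
    (h (vbasis {:A})`_i : fdnormed B).
have GE (h : 'Hom(A, B)) (x : A) : h x = G h x.
  rewrite {1}(@fd_coord_sum A x) linear_sum; apply: eq_bigr => i _.
  by rewrite linearZ.
rewrite GE; under eq_cvg do rewrite GE.
apply: sumf_cvg => i; apply: cvgZ.
  exact: (fd_linear_cvg (coord_is_scalar _ _)).
apply: (fd_linear_cvg (f := fun h : 'Hom(A, B) => (h _ : fdnormed B))) => //.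
by move=> a h k; rewrite add_lfunE scale_lfunE.
Qed.

(** An operator is recovered linearly from its values on a basis. *)
Lemma lfun_cvg A B (T : Type) (F : set_system T) {FF : Filter F}
    (f : T -> fdnormed 'Hom(A, B)) (f0 : fdnormed 'Hom(A, B)) :
  (forall x : A, (f t x : fdnormed B) @[t --> F] --> (f0 x : fdnormed B)) ->
    f @ F --> f0.
Proof.
move=> ff.
pose L i (b : B) : 'Hom(A, B) := linfun (fun x => coord (vbasis {:A}) i x *: b).
have LE i b x : L i b x = coord (vbasis {:A}) i x *: b.
  rewrite linfunE_of_linear// => a u v; by rewrite linearP/= scalerDl scalerA.
pose G (h : 'Hom(A, B)) : fdnormed 'Hom(A, B) :=
  \sum_(i < \dim {:A}) (L i (h (vbasis {:A})`_i) : fdnormed 'Hom(A, B)).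
have GE (h : 'Hom(A, B)) : h = G h.
  apply/lfunP => x; rewrite {1}(@fd_coord_sum A x) linear_sum sum_lfunE;
    apply: eq_bigr => i _.
  by rewrite linearZ LE.
rewrite (GE f0); under eq_cvg => t do rewrite (GE (f t)).
apply: sumf_cvg => i; apply: (fd_linear_cvg
  (f := fun b : B => (L i b : fdnormed _))) => //.
by move=> a h k; apply/lfunP => x; rewrite add_lfunE scale_lfunE !LE scalerDr
  !scalerA mulrC.
Qed.

Lemma lfun_bounded A B : exists2 M, 0 < M &
  forall (f : fdnormed 'Hom(A, B)) (x : fdnormed A),
    `|f x : fdnormed B| <= M * `|f| * `|x|.
Proof.
pose e (i : 'I_(\dim {:A})) (h : 'Hom(A, B)) : fdnormed B := h (vbasis {:A})`_i.
have el i : linear (e i) by move=> a h k; rewrite /e add_lfunE scale_lfunE.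
have /choice[M HM] : forall i, exists M, 0 <= M /\ forall f :
  fdnormed 'Hom(A, B), `|e i f| <= M * `|f|.
  move=> i;
  pose f' : {linear fdnormed 'Hom(A, B) -> fdnormed B} :=
    HB.pack (e i : fdnormed _ -> fdnormed _)
      (GRing.isLinear.Build R (fdnormed 'Hom(A, B)) (fdnormed B) _ (e i)
      (el i)).
  by have [M M0 H] := fd_linear_bounded f'; exists M; split=> //; exact: ltW.
exists (1 + \sum_i M i) => [|f x].
  by rewrite ltr_pwDl// sumr_ge0// => i _; have [] := HM i.
rewrite [in leLHS](@fd_coord_sum A x) linear_sum mulrDl mulrDl mul1r ler_wpDl//.
rewrite (le_trans (ler_norm_sum _ _ _))// !mulr_suml ler_sum// => i _.
rewrite linearZZ normrZ [leRHS]mulrC ler_pM// ?fd_norm_coord//.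
by have [_] := HM i; exact.
Qed.

(** Coordinates in a basis are an isometry onto row vectors, where bounded
    closed sets are compact. *)
Lemma fd_sphere_compact A : compact [set x : fdnormed A | `|x| = 1].
Proof.
pose vec v : fdnormed A := vecof (vbasis {:A}) v.
have vecN v : `|vec v| = `|v|.
  by rewrite [LHS](_ : _ = `|rVof (vbasis {:A}) (vec v)|)// vecofK// vbasisP.
have -> : [set x : fdnormed A | `|x| = 1] = vec @` [set v | `|v| = 1].
  apply/seteqP; split=> [x x1|_ [v v1 <-]]; last by rewrite /= vecN.
  by exists (rVof (vbasis {:A}) x); rewrite // /vec rVofK// vbasisP.
apply: continuous_compact.
  apply: continuous_subspaceT.
  have lvec : linear vec by exact: linearP.
  pose vec' : {linear 'rV_(\dim {:A}) -> fdnormed A} :=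
    HB.pack vec (GRing.isLinear.Build R _ (fdnormed A) _ vec lvec).
  apply: (@bounded_linear_continuous _ _ _ vec'); apply/linear_boundedP.
  exists 1; split=> // r r1 v; rewrite [leLHS]vecN.
  by rewrite ler_peMl// ltW.
apply: bounded_closed_compact.
  by exists 1; split=> // M M1 v /= ->; exact: ltW.
have -> : [set v : 'rV[R]_(\dim {:A}) | `|v| = 1] = Num.norm @^-1` [set 1]
  by [].
apply: preimage_closed.
  by move=> v _; exact: norm_continuous.
by apply: closed_eq.
Qed.

End FiniteDimensionalTopology.

Lemma lfun3_bounded (R : realType) (A B C D : vectType R)
    (q : 'Hom(A, 'Hom(B, 'Hom(C, D)))) :
  exists2 M, 0 < M & forall (a : fdnormed A) (b : fdnormed B) (c : fdnormed C),
    `|q a b c : fdnormed D| <= M * `|a| * `|b| * `|c|.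
Proof.
have [M1 M10 H1] := lfun_bounded C D.
have [M2 M20 H2] := lfun_bounded B 'Hom(C, D).
have [M3 M30 H3] := lfun_bounded A 'Hom(B, 'Hom(C, D)).
exists (M1 * M2 * M3 * (1 + `|q : fdnormed _|)) => [|a b c].
  by rewrite !mulr_gt0// ltr_pwDl.
rewrite (le_trans (H1 (q a b) c))// ler_wpM2r//.
rewrite -!mulrA ler_pM2l//; apply: le_trans (H2 (q a) b) _.
rewrite -!mulrA ler_pM2l// [leRHS]mulrA mulrA ler_wpM2r//.
apply: le_trans (H3 (q : fdnormed _) a) _.
by rewrite -!mulrA ler_pM2l// ler_wpM2r// lerDr.
Qed.

(** * Differentials by increments, and the product rule *)

Lemma near_dist_lt (R : realType) (V : normedModType R) (x : V) (d : R) :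
  0 < d -> \forall y \near x, `|y - x| < d.
Proof.
move=> d0; apply/nbhs_ballP; exists d => // y.
by rewrite -ball_normE/= distrC.
Qed.

Section DifferentialEpsilon.
Variables (R : realType) (V W : normedModType R).

Lemma is_diff_eps (f df : V -> W) (x : V) : linear df -> continuous df ->
    (forall e, 0 < e -> \forall y \near x,
      `|f y - f x - df (y - x)| <= e * `|y - x|) ->
  is_diff x f df.
Proof.
move=> ldf cdf fdf.
pose df' : {linear V -> W} := HB.pack df (GRing.isLinear.Build R V W _ df ldf).
have fE : f \o shift x = cst (f x) + df' +o_ 0 id.
  apply/eqaddoP => e /fdf; rewrite (near_shift 0 x) subr0.
  apply: filterS => y; rewrite !fctE/= addrK.
  by rewrite opprD addrA.
have dE := @diff_unique _ _ _ f df' x cdf fE.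
by apply: DiffDef => //; apply/diff_locallyP; rewrite dE.
Qed.

Lemma diff_eps (f : V -> W) (x : V) : differentiable f x ->
  forall e, 0 < e -> \forall y \near x,
      `|f y - f x - 'd f x (y - x)| <= e * `|y - x|.
Proof.
move=> /diff_locallyP[_ /eqaddoP fE] e /fE H; rewrite (near_shift 0 x) subr0.
by apply: filterS H => y; rewrite !fctE/= addrK opprD addrA.
Qed.

Lemma diff_lipschitz (f : V -> W) (x : V) : differentiable f x ->
  exists2 M, 0 < M & \forall y \near x, `|f y - f x| <= M * `|y - x|.
Proof.
move=> df; have [M M0 dM] := linear_lipschitz (diff_continuous df).
exists (1 + M); first by rewrite addr_gt0.
apply: filterS (diff_eps df ltr01) => y fy.
rewrite -[f y - f x](subrK ('d f x (y - x))) (le_trans (ler_normD _ _))//.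
by rewrite mulrDl lerD.
Qed.

End DifferentialEpsilon.

Section ProductRule.
Variables (R : realType) (E : normedModType R).
Implicit Types A B : vectType R.

(** Caratheodory's form of the chain rule: an increment of w that is the image
    of an increment of k under operators S y continuous at x. The
    differentiability of implicitly defined functions comes down to this, S
    being the inverse of the linearized equation. *)
Lemma is_diff_slope A B (w : E -> fdnormed B) (k : E -> fdnormed A)
    (S : E -> fdnormed 'Hom(A, B)) (x : E) :
  differentiable k x -> {for x, continuous S} ->
  (\forall y \near x, w y - w x = S y (k y - k x)) ->
  is_diff x w (fun v => S x ('d k x v)).
Proof.
move=> dk cS wE; have [C C0 HC] := lfun_bounded A B.
have [M M0 HM] := diff_lipschitz dk.
apply: is_diff_eps => [a u v||e e0].
- by rewrite linearP/= linearP.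
- move=> v; apply: (@cvg_lfun _ A B) => //; first exact: cvg_cst.
  exact: diff_continuous.
(* Half of e is spent on the variation of S, half on the error in k. *)
have C20 : 0 < C * M by rewrite mulr_gt0.
have [N N0 HN] : exists2 N, 0 < N & forall z : fdnormed A,
  `|S x z : fdnormed B| <= N * `|z|.
  exists (C * `|S x| + 1); first by rewrite ltr_wpDl// mulr_ge0// ltW.
  by move=> z; rewrite (le_trans (HC _ _))// ler_wpM2r// lerDl.
have e1 : 0 < e / 2 / (C * M) by rewrite !divr_gt0.
have e2 : 0 < e / 2 / N by rewrite !divr_gt0.
have dkx := diff_eps dk e2.
near=> y.
have -> : w y - w x - S x ('d k x (y - x)) =
    (S y - S x : 'Hom(A, B)) (k y - k x) + S x (k y - k x - 'd k x (y - x)).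
  rewrite (near wE y)// add_lfunE opp_lfunE.
  move: (k y - k x) ('d k x (y - x)) => a b.
  by rewrite (linearB (S x : 'Hom(A, B)) a b) addrA subrK.
rewrite (le_trans (ler_normD _ _))// [e in leRHS]splitr mulrDl lerD//.
  rewrite (le_trans (HC _ _))//.
  have -> : e / 2 * `|y - x| = C * (e / 2 / (C * M)) * (M * `|y - x|).
    by field; rewrite !gt_eqF.
  rewrite ler_pM//; last by near: y.
    by rewrite mulr_ge0// ltW.
  rewrite ler_pM2l// distrC ltW//; near: y.
  exact: (@cvgr_dist_lt _ _ _ (nbhs x) _ S (S x)).
rewrite (le_trans (HN _))// -ler_pdivlMl// mulrC mulrAC -mulrA mulrA.
by near: y.
Unshelve. all: by end_near. Qed.

Lemma is_diff_fd_linear A B (f : 'Hom(A, B)) (u du : E -> fdnormed A) (x : E) :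
  is_diff x u du -> is_diff x (fun y => f (u y) : fdnormed B)
    (fun v => f (du v)).
Proof.
move=> du_; rewrite -[du]diff_val.
apply: (@is_diff_slope A B _ u (fun=> f)) => //; first exact: cvg_cst.
by apply: nearW => y; exact: (esym (linearB f (u y : A) (u x))).
Qed.

(** Split f y (g y) as f y (g y - g x) + f y (g x): the first term is an
    instance of [is_diff_slope], the second is linear in f y. *)
Lemma is_diff_lfun A B (f df : E -> fdnormed 'Hom(A, B))
    (g dg : E -> fdnormed A) (x : E) :
  is_diff x f df -> is_diff x g dg ->
  is_diff x (fun y => f y (g y) : fdnormed B)
    (fun v => f x (dg v) + df v (g x)).
Proof.
move=> f' g'.
pose ev : 'Hom('Hom(A, B), B) := linfun (fun h : 'Hom(A, B) => h (g x)).
have evE (h : 'Hom(A, B)) : ev h = h (g x).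
  by rewrite linfunE_of_linear// => a u v; rewrite add_lfunE scale_lfunE.
have q' := is_diff_fd_linear ev f'.
have p' : is_diff x (fun y => f y (g y) - f y (g x) : fdnormed B)
  (fun v => f x (dg v)).
  rewrite -[dg]diff_val; apply: (@is_diff_slope A B _ g f) => //.
    exact: differentiable_continuous.
  apply: nearW => y; rewrite subrr subr0.
  exact: (esym (linearB (f y : 'Hom(A, B)) (g y : A) (g x))).
have := is_diffD p' q'.
congr (is_diff_def _ _ _); apply/funext => y; rewrite !fctE/= evE//.
by rewrite subrK.
Qed.

End ProductRule.

(** * Bounded inverses and fixed points *)

Section InverseContinuity.
Variable R : realType.

Lemma lker0_bounded_below (A : vectType R) (G : 'End(A)) (M : R) :
  (forall e : fdnormed A, `|e| <= M * `|G e : fdnormed A|) -> lker G == 0%VS.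
Proof.
move=> GM; apply/lker0P => u v Guv; apply/eqP; rewrite -subr_eq0.
have Guv0 : G (u - v) = 0 by rewrite linearB/= Guv subrr.
by have := GM (u - v); rewrite Guv0 normr0 mulr0 normr_le0.
Qed.

(** From G0^-1 x - (G t)^-1 x = (G t)^-1 (G t (G0^-1 x) - x): the outer
    operator is bounded by M and the argument tends to 0. *)
Lemma lfun_inv_cvg (A : vectType R) (T : Type) (F : set_system T)
    (FF : Filter F) (M : R)
    (G : T -> fdnormed 'End(A)) (G0 : fdnormed 'End(A)) : 0 < M ->
    (\forall t \near F, forall e : fdnormed A,
      `|e| <= M * `|G t e : fdnormed A|) ->
    (forall e : fdnormed A, `|e| <= M * `|G0 e : fdnormed A|) ->
    G @ F --> G0 ->
  ((G t)^-1%VF : fdnormed 'End(A)) @[t --> F] --> (G0^-1%VF : fdnormed 'End(A)).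
Proof.
move=> M0 GM G0M GG0; apply: lfun_cvg => x.
have kG0 := lker0_bounded_below G0M.
have /cvgrPdist_lt H : (G t (G0^-1%VF x) : fdnormed A) @[t --> F] -->
  (x : fdnormed A).
  rewrite -[X in _ --> X](lker0_lfunVK kG0); apply: cvg_lfun => //;
    exact: cvg_cst.
apply/cvgrPdist_lt => e e0; have := H (e / M) (divr_gt0 e0 M0).
apply: filterS2 GM => t GMt; rewrite ltr_pdivlMr// mulrC; apply: le_lt_trans;
  rewrite distrC.
apply: le_trans (GMt _) _; rewrite ler_pM2l//.
have GK : G t ((G t)^-1%VF x) = x := lker0_lfunVK (lker0_bounded_below GMt) x.
have <- : G t ((G t)^-1%VF x - G0^-1%VF x) = x - G t (G0^-1%VF x) :> fdnormed A.
  by rewrite linearB/= GK.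
by [].
Qed.

End InverseContinuity.

Lemma contraction_bounded_below (R : realType) (A : vectType R) (D : 'End(A)) :
    (forall e : fdnormed A, `|D e : fdnormed A| <= 2^-1 * `|e|) ->
  forall e : fdnormed A, `|e| <= 2 * `|(\1%VF - D : 'End(A)) e : fdnormed A|.
Proof.
move=> De e; rewrite add_lfunE opp_lfunE id_lfunE.
have := ler_normD (e - D e) (D e : fdnormed A); rewrite subrK => eD.
by have := De e; move: eD; set a := `|e|; set b := `|D e : fdnormed A|; lra.
Qed.

Lemma ball_fixed_point (R : realType) (X : completeNormedModType R) (f : X -> X)
    (a : X) (r : R) :
  0 <= r -> `|f a - a| <= r / 2 ->
  (forall x y, `|x - a| <= r -> `|y - a| <= r ->
    `|f x - f y| <= 2^-1 * `|x - y|) ->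
  exists2 x, `|x - a| <= r & f x = x.
Proof.
move=> r0 fa fxy; pose U := [set x | `|x - a| <= r].
have Ua : U a by rewrite /U/= subrr normr0.
have fU : set_fun U U f.
  move=> x Ux; rewrite /U/= -[f x](subrK (f a)) -addrA
    (le_trans (ler_normD _ _))//.
  by rewrite [leRHS]splitr lerD// (le_trans (fxy _ _ _ _))// mulrC ler_wpM2r.
have cf : is_contraction (mkfun fU).
  exists (2^-1)%:nng; split => /=; first by rewrite invf_lt1// ltr1n.
  by move=> [x y] [/= Ux Uy]; exact: fxy.
have clU : closed U.
  have -> : U = (fun x => `|x - a|) @^-1` [set t | t <= r] by [].
  apply: preimage_closed; last exact: closed_le.
  move=> x _; apply: cvg_norm; apply: cvgB => //; exact: cvg_cst.
have [|x Ux xE] := banach_fixed_point cf clU; first by exists a.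
by exists x => //; rewrite [RHS]xE.
Qed.

(** * Smooth implicit functions for quadratic equations *)

Section SmoothByClosure.
Variables (R : realType) (V W : normedModType R).

Lemma is_diff_near_eq (f g dg : V -> W) (x : V) :
  is_diff x g dg -> (\forall y \near x, f y = g y) -> is_diff x f dg.
Proof.
move=> g' fg; have dgx : differentiable g x by [].
rewrite -[dg]diff_val; apply: is_diff_eps;
  [exact: linearP|exact: diff_continuous|].
move=> e e0; have fgx := nbhs_singleton fg.
by apply: filterS2 fg (diff_eps dgx e0) => y ->; rewrite fgx.
Qed.

(** By induction on the order of differentiability: the derivatives of a member
    are members. This replaces the stability of smoothness under sums,
    products and inverses. *)
Lemma smooth_on_closed_class (U : set V) (S : (V -> W) -> Prop) : open U ->
    (forall f, S f -> exists2 df : V -> V -> W, forall v, S (df v) &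
      forall x, U x -> is_diff x f (fun v => df v x)) ->
  forall f, S f -> smooth_on U f.
Proof.
move=> oU HS f Sf n.
have : forall x, U x -> f x = f x by [].
(* The induction needs equality with a member on U only: the differentials on
   U are not affected by the values elsewhere. *)
move: {1 3}f => g.
elim: n f g Sf => [|n ih] f g Sf fg /=; have [df Sdf f'] := HS _ Sf.
  move=> x Ux; apply: differentiable_continuous.
  have gE : \forall y \near x, g y = f y by near=> y; apply: fg; near: y;
    exact: open_nbhs_nbhs.
  by have [] := is_diff_near_eq (f' x Ux) gE.
have g' x : U x -> is_diff x g (fun v => df v x).
  move=> Ux; apply: is_diff_near_eq (f' x Ux) _.
  by near=> y; apply: fg; near: y; exact: open_nbhs_nbhs.
split=> [x /g'[]//|v]; apply: (ih (df v)) => // x /g' gx.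
by rewrite diff_val.
Unshelve. all: by end_near. Qed.

End SmoothByClosure.

Section QuadraticImplicitFunction.
Variables (R : realType) (E0 F0 : vectType R).
Local Notation E := (fdnormed E0).
Local Notation F := (fdnormed F0).
Variables (c : F) (A : 'End(F0)) (q : 'Hom(E0, 'Hom(F0, 'Hom(F0, F0)))).

Definition quad (x : E) (g : F) : F := c + A g + q x g g.

(** The divided difference of g |-> quad x g between g and f; on the diagonal
    it is the partial derivative. *)
Definition quad_slope (x : E) (f g : F) : fdnormed 'End(F0) :=
  A + linfun (fun e => q x e f) + q x g.

Lemma quad_slopeE x f g e : quad_slope x f g e = A e + q x e f + q x g e.
Proof.
rewrite !add_lfunE linfunE_of_linear// => a u v.
by rewrite linearP add_lfunE scale_lfunE.
Qed.

Lemma quad_slopeP x f g : quad x f - quad x g = quad_slope x f g (f - g).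
Proof.
rewrite quad_slopeE /quad !linearB/= add_lfunE opp_lfunE.
move: (A f) (A g) (q x f f) (q x g g) (q x g f) => a b d e j.
rewrite !opprD !addrA (AC 6 (1*4*2*5*3*6)) /= subrr add0r.
by rewrite subrK.
Qed.

Lemma cvg_lfun3 (T : Type) (G : set_system T) (FG : Filter G) (x : T -> E)
    (f g : T -> F) (x0 : E) (f0 g0 : F) :
  x @ G --> x0 -> f @ G --> f0 -> g @ G --> g0 ->
  (q (x t) (f t) (g t) : F) @[t --> G] --> (q x0 f0 g0 : F).
Proof.
move=> xx ff gg; do 3?[apply: cvg_lfun => //]; exact: cvg_cst.
Qed.

Lemma quad_slope_cvg (T : Type) (G : set_system T) (FG : Filter G) (x : T -> E)
    (f g : T -> F) (x0 : E) (f0 g0 : F) :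
  x @ G --> x0 -> f @ G --> f0 -> g @ G --> g0 ->
  quad_slope (x t) (f t) (g t) @[t --> G] --> quad_slope x0 f0 g0.
Proof.
move=> xx ff gg; apply: lfun_cvg => e; rewrite quad_slopeE;
  under eq_cvg do rewrite quad_slopeE.
apply: cvgD; [apply: cvgD; first exact: cvg_cst|]; apply: cvg_lfun3 => //;
  exact: cvg_cst.
Qed.

Lemma is_diff_lfun3 (x : E) (u du w dw : E -> F) : is_diff x u du ->
    is_diff x w dw ->
  is_diff x (fun y => q y (u y) (w y) : F)
    (fun v => q x (u x) (dw v) + (q x (du v) (w x) + q v (u x) (w x))).
Proof.
move=> u' w'.
have q1 := is_diff_fd_linear q (is_diff_id x).
have q2 := is_diff_lfun q1 u'.
have := is_diff_lfun q2 w'.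
by congr is_diff_def; apply/funext => v; rewrite add_lfunE.
Qed.

Lemma is_diff_lfun2 (b : 'Hom(F0, 'Hom(F0, F0))) (x : E) (u du w dw : E -> F) :
    is_diff x u du -> is_diff x w dw ->
  is_diff x (fun y => b (u y) (w y) : F)
    (fun v => b (u x) (dw v) + b (du v) (w x)).
Proof.
by move=> u' w'; apply: is_diff_lfun (is_diff_fd_linear b u') w'.
Qed.

End QuadraticImplicitFunction.

Section SolutionBranch.
Variables (R : realType) (E0 F0 : vectType R).
Local Notation E := (fdnormed E0).
Local Notation F := (fdnormed F0).
Variables (c : F) (A : 'End(F0)) (q : 'Hom(E0, 'Hom(F0, 'Hom(F0, F0)))).
Local Notation L := (quad_slope A q).
Local Notation Psi := (quad c A q).
Variables (W : set E) (h : E -> F).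
Hypotheses (oW : open W) (hW : forall x, W x -> Psi x (h x) = h x).
Hypothesis (LW : forall x y z e, W x -> W y -> W z ->
    `|L x (h y) (h z) e : F| <= 2^-1 * `|e : F|).

Hypothesis (hB : exists N, forall x, W x -> `|h x| <= N).

(** For x = y, the inverse of the derivative at h x of g |-> g - quad x g. *)
Definition resolvent (x y : E) : fdnormed 'End(F0) :=
  ((\1%VF - L x (h y) (h x) : 'End(F0))^-1)%VF.

Lemma resolventP x y e : W x -> W y ->
    resolvent x y (e - L x (h y) (h x) e) = e.
Proof.
move=> Wx Wy; rewrite -[X in X - _]id_lfunE -opp_lfunE -add_lfunE.
apply: lker0_lfunK; apply: lker0_bounded_below (contraction_bounded_below _) =>
  z.
exact: LW.
Qed.

Lemma resolvent_cvg (T : Type) (G : set_system T) (FG : Filter G)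
    (x y : T -> E) x0 y0 :
  W x0 -> W y0 -> (\forall t \near G, W (x t)) ->
    (\forall t \near G, W (y t)) ->
  x @ G --> x0 -> h (x t) @[t --> G] --> h x0 -> h (y t) @[t --> G] --> h y0 ->
  resolvent (x t) (y t) @[t --> G] --> resolvent x0 y0.
Proof.
move=> Wx0 Wy0 Wx Wy xx hx hy.
apply: (@lfun_inv_cvg _ _ _ _ _ 2) => //.
- apply: filterS2 Wx Wy => t Wx Wy; apply: contraction_bounded_below => e;
  exact: LW.
- apply: contraction_bounded_below => e; exact: LW.
- by apply: cvgB; [exact: cvg_cst|exact: quad_slope_cvg].
Qed.

Lemma resolventVP x y e : W x -> W y ->
  resolvent x y e - L x (h y) (h x) (resolvent x y e) = e.
Proof.
move=> Wx Wy; rewrite -[X in X - _]id_lfunE -opp_lfunE -add_lfunE.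
apply: lker0_lfunVK; apply: lker0_bounded_below (contraction_bounded_below _) =>
  z.
exact: LW.
Qed.

(** Subtract the equations of h y and h x, and move the slope of the quadratic
    map to the left-hand side. *)
Lemma branch_slope x y : W x -> W y ->
  h y - h x - L x (h y) (h x) (h y - h x) = q (y - x) (h y) (h y).
Proof.
move=> Wx Wy; rewrite -(quad_slopeP c) -{1}(hW Wx) -{1}(hW Wy) /quad.
have -> : q (y - x) (h y) (h y) = q y (h y) (h y) - q x (h y) (h y).
  by rewrite (linearB q (y : E0) x) !add_lfunE !opp_lfunE.
by rewrite opprB addrA subrK opprD addrACA subrr add0r.
Qed.

Lemma branch_increment x y : W x -> W y ->
  h y - h x = resolvent x y (q (y - x) (h y) (h y)).
Proof. by move=> Wx Wy; rewrite -branch_slope// resolventP. Qed.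

Lemma branch_continuous x : W x -> {for x, continuous h}.
Proof.
move=> Wx; have [M M0 HM] := lfun3_bounded q; have [N HN] := hB.
have N0 : 0 <= N by apply: le_trans (HN x Wx).
have K0 : 0 < 2 * M * N * N + 1 by rewrite ltr_wpDl// !mulr_ge0// ltW.
apply/(@cvgrPdist_lt _ _ _ (nbhs x)) => e e0; near=> y.
have Wy : W y by near: y; exact: open_nbhs_nbhs.
have := contraction_bounded_below (fun e => LW e Wx Wy Wx) (h y - h x).
rewrite add_lfunE opp_lfunE id_lfunE branch_slope// distrC => /le_lt_trans;
  apply.
have yx : `|y - x| < e / (2 * M * N * N + 1).
  by near: y; apply: near_dist_lt; exact: divr_gt0.
apply: (@le_lt_trans _ _ ((2 * M * N * N + 1) * `|y - x|)); last first.
  by rewrite mulrC -ltr_pdivlMr.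
rewrite [leRHS]mulrDl mul1r ler_wpDr//.
have hN : `|h y| * `|h y| <= N * N by rewrite ler_pM// HN.
apply: (@le_trans _ _ (2 * (M * `|y - x| * `|h y| * `|h y|))).
  by rewrite ler_pM2l.
have -> : 2 * (M * `|y - x| * `|h y| * `|h y|) = 2 * M * `|y - x| *
  (`|h y| * `|h y|).
  by ring.
have -> : 2 * M * N * N * `|y - x| = 2 * M * `|y - x| * (N * N) by ring.
by rewrite ler_wpM2l// !mulr_ge0// ltW.
Unshelve. all: by end_near. Qed.

Lemma branch_is_diff x : W x -> is_diff x h
    (fun v => resolvent x x (q v (h x) (h x))).
Proof.
move=> Wx.
pose Q y : fdnormed 'Hom(E0, F0) := linfun (fun v => q v (h y) (h y)).
have QE y v : Q y v = q v (h y) (h y).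
  by rewrite linfunE_of_linear// => a u w;
    rewrite linearP !(add_lfunE, scale_lfunE).
pose S y : fdnormed 'Hom(E0, F0) := (resolvent x y \o Q y)%VF.
have -> : (fun v => resolvent x x (q v (h x) (h x))) =
  (fun v => S x ('d id x v)).
  by apply/funext => v; rewrite diff_val comp_lfunE QE.
have hx := branch_continuous Wx.
apply: is_diff_slope => //.
  apply: (@lfun_cvg _ _ _ _ (nbhs x)) => v; rewrite comp_lfunE QE;
    under eq_cvg do rewrite comp_lfunE QE.
  apply: (@cvg_lfun _ _ _ _ (nbhs x)); last by apply: cvg_lfun3 => //;
    exact: cvg_cst.
  apply: (@resolvent_cvg _ (nbhs x)) => //; try exact: cvg_cst.
  - by near=> y.
  - exact: open_nbhs_nbhs.
near=> y.
have Wy : W y by near: y; exact: open_nbhs_nbhs.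
by rewrite comp_lfunE QE branch_increment.
Unshelve. all: by end_near. Qed.

(** The value w of the resolvent solves w = u + L w; freezing w at x in L w
    gives a differentiable k with increments of w equal to the resolvent
    applied to increments of k, and [is_diff_slope] applies. The two zeros
    are the derivatives of the frozen w. *)
Lemma resolvent_is_diff x (u du dh : E -> F) : W x -> is_diff x u du ->
    is_diff x h dh ->
  is_diff x (fun y => resolvent y y (u y) : F)
    (fun v => let w := resolvent x x (u x) in resolvent x x
       (du v + (q x w (dh v) + (q x 0 (h x) + q v w (h x))
         + (q x (h x) 0 + (q x (dh v) w + q v (h x) w))))).
Proof.
move=> Wx u' h'; set w : F := resolvent x x (u x).
pose k y : F := u y + (q y w (h y) + q y (h y) w) + A w.
have k' := is_diffD (is_diffD u' (is_diffD
   (is_diff_lfun3 q (is_diff_cst w x) h')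
     (is_diff_lfun3 q h' (is_diff_cst w x))))
   (is_diff_cst (A w : F) x).
have -> : (fun v => let w := resolvent x x (u x) in resolvent x x
       (du v + (q x w (dh v) + (q x 0 (h x) + q v w (h x))
         + (q x (h x) 0 + (q x (dh v) w + q v (h x) w))))) =
           (fun v => resolvent x x ('d k x v)).
  by apply/funext => v /=; rewrite [in RHS]diff_val !fctE/= addr0.
have hx := branch_continuous Wx.
apply: (@is_diff_slope _ _ _ _ _ k (fun y => resolvent y y)).
- by case: k'.
- apply: (@resolvent_cvg _ (nbhs x) _ id id) => //; try exact: open_nbhs_nbhs.
near=> y.
have Wy : W y by near: y; exact: open_nbhs_nbhs.
have ky z : k z = u z + L z (h z) (h z) w.
  by rewrite quad_slopeE /k -addrA; congr (_ + _); rewrite addrC addrA.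
have -> : k x = w by rewrite ky -[X in X + _](resolventVP _ Wx Wx) subrK.
have -> : k y - w = u y - (w - L y (h y) (h y) w).
  by rewrite ky opprB addrA.
rewrite [RHS](linearB (resolvent y y : 'End(F0)) (u y : F0)) /=.
by rewrite resolventP.
Unshelve. all: by end_near. Qed.

(** The smallest class containing h that is seen to be closed under directional
    derivatives: the derivative of h is a resolvent applied to a quadratic
    term, and the derivative of a resolvent involves resolvents and
    quadratic terms only. *)
Inductive branch_poly : (E -> F) -> Prop :=
| branch_cst a : branch_poly (fun=> a)
| branch_self : branch_poly h
| branch_add u w : branch_poly u -> branch_poly w -> branch_poly (u + w)
| branch_quad_cst v u w : branch_poly u -> branch_poly w ->
    branch_poly (fun y => q v (u y) (w y))
| branch_quad u w : branch_poly u -> branch_poly w ->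
    branch_poly (fun y => q y (u y) (w y))
| branch_res u : branch_poly u -> branch_poly (fun y => resolvent y y (u y)).

Lemma branch_smooth : smooth_on W h.
Proof.
apply: (smooth_on_closed_class oW (S := branch_poly)); last exact: branch_self.
have sh v : branch_poly (fun y => resolvent y y (q v (h y) (h y))).
  by apply: branch_res; apply: branch_quad_cst; exact: branch_self.
move=> f; elim=> {f} [a||u w _ [du Su u'] _ [dw Sw w']|b u w Hu [du Su u'] Hw
  [dw Sw w']|u w Hu [du Su u'] Hw [dw Sw w']|u Hu [du Su u']].
- exists (fun _ _ => 0) => [v|x _]; first exact: branch_cst.
  exact: is_diff_cst.
- exists (fun v y => resolvent y y (q v (h y) (h y))) => // x Wx.
  exact: branch_is_diff.
- exists (fun v => du v + dw v) => [v|x Wx]; first exact: branch_add.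
  by apply: is_diffD; [exact: u'|exact: w'].
- exists (fun v => (fun y => q b (u y) (dw v y)) +
  (fun y => q b (du v y) (w y))) => [v|x Wx].
    by apply: branch_add; apply: branch_quad_cst.
  by apply: (is_diff_lfun2 (q b)); [exact: u'|exact: w'].
- exists (fun v => (fun y => q y (u y) (dw v y)) +
  ((fun y => q y (du v y) (w y)) + (fun y => q v (u y) (w y)))) => [v|x Wx].
    apply: branch_add; first exact: branch_quad.
    by apply: branch_add; [exact: branch_quad|exact: branch_quad_cst].
  by apply: is_diff_lfun3; [exact: u'|exact: w'].
- pose dh v y := resolvent y y (q v (h y) (h y)).
  exists (fun v y => let w := resolvent y y (u y) in resolvent y y
       (du v y + (q y w (dh v y) + (q y 0 (h y) + q v w (h y))
         + (q y (h y) 0 + (q y (dh v y) w + q v (h y) w))))) => [v|x Wx].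
    apply: branch_res.
    have hw := branch_res Hu.
    apply: (branch_add (Su v)).
    have B0 := branch_cst 0.
    have Bh := branch_self.
    apply: (@branch_add (fun y => _ + _) (fun y => _ + _));
      apply: (@branch_add _ (fun y => _ + _)).
    + apply: branch_quad hw (sh v).
    + by apply: (branch_add (branch_quad B0 Bh)); exact: branch_quad_cst.
    + exact: branch_quad.
    + by apply: (branch_add (branch_quad (sh v) hw)); exact: branch_quad_cst.
  apply: resolvent_is_diff => //; [exact: u'|exact: branch_is_diff].
Qed.

End SolutionBranch.

(** The derivative in g vanishes at (x0, g0), so by continuity the right-hand
    side is a contraction of ratio 1/2 of a fixed ball around g0, for all x
    close to x0. *)
Theorem quadratic_implicit_function (R : realType) (E0 F0 : vectType R)
    (c : fdnormed F0) (A : 'End(F0)) (q : 'Hom(E0, 'Hom(F0, 'Hom(F0, F0))))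
    (x0 : fdnormed E0) (g0 : fdnormed F0) :
    quad c A q x0 g0 = g0 -> (forall e, quad_slope A q x0 g0 g0 e = 0) ->
  exists (W : set (fdnormed E0)) (h : fdnormed E0 -> fdnormed F0),
    [/\ open W, W x0, h x0 = g0, smooth_on W h &
        forall x, W x -> quad c A q x (h x) = h x].
Proof.
move=> fix0 slope0; have [C C0 HC] := lfun_bounded F0 F0.
pose T := (fdnormed E0 * fdnormed F0 * fdnormed F0)%type.
pose p0 : T := (x0, g0, g0).
have pfst : p.1 @[p --> p0] --> (x0, g0).
  exact: (@cvg_fst _ _ (nbhs (x0, g0)) (nbhs g0) _).
have Lp0 : quad_slope A q p.1.1 p.1.2 p.2 @[p --> p0] -->
  (0 : fdnormed 'End(F0)).
  have <- : quad_slope A q x0 g0 g0 = 0.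
    by apply/lfunP => e; rewrite slope0 zero_lfunE.
  apply: (@quad_slope_cvg _ _ _ _ _ _ (nbhs p0) _ (fun p : T => p.1.1)
    (fun p : T => p.1.2) (fun p : T => p.2)).
  - exact: (cvg_comp _ _ pfst (@cvg_fst _ _ (nbhs x0) (nbhs g0) _)).
  - exact: (cvg_comp _ _ pfst (@cvg_snd _ _ (nbhs x0) (nbhs g0) _)).
  - exact: (@cvg_snd _ _ (nbhs (x0, g0)) (nbhs g0) _).
have C2 : 0 < (2 * C)^-1 by rewrite invr_gt0 mulr_gt0.
have /cvgrPdist_lt/(_ _ C2)/nbhs_ballP[r /= r0 Hr] := Lp0.
have Lr (x : fdnormed E0) (f g : fdnormed F0) (e : fdnormed F0) :
  `|x - x0| < r -> `|f - g0| < r -> `|g - g0| < r ->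
    `|quad_slope A q x f g e : fdnormed F0| <= 2^-1 * `|e|.
  move=> xr fr gr; have := Hr (x, f, g).
  have H : ball p0 r (x, f, g) by split; [split|]; rewrite -ball_normE/= distrC.
  move=> /(_ H); rewrite /= sub0r normrN => /ltW Lle.
  rewrite (le_trans (HC _ _))// ler_wpM2r//.
  by rewrite -ler_pdivlMl// -invfM mulrC.
have fix_cvg : (quad c A q x g0 - g0) @[x --> x0] --> (0 : fdnormed F0).
  have -> : 0 = (c + A g0) + q x0 g0 g0 - g0 :> fdnormed F0.
    by rewrite -[X in X - _]/(quad c A q x0 g0) fix0 subrr.
  apply: (@cvgB _ _ _ (nbhs x0)); last exact: (@cvg_cst _ _ _ (nbhs x0)).
  apply: (@cvgD _ _ _ (nbhs x0)); first exact: (@cvg_cst _ _ _ (nbhs x0)).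
  apply: (@cvg_lfun3 _ _ _ _ _ (nbhs x0)); first exact: cvg_id.
    exact: (@cvg_cst _ _ _ (nbhs x0)).
  exact: (@cvg_cst _ _ _ (nbhs x0)).
have r4 : 0 < r / 2 / 2 by rewrite !divr_gt0.
have /cvgrPdist_lt/(_ _ r4)/nbhs_ballP[d /= d0 Hd] := fix_cvg.
(* The radius r controls the contraction, d the displacement of g0. *)
pose W := ball x0 (Num.min r d).
have Wr x : W x -> `|x - x0| < r.
  by rewrite /W -ball_normE/= distrC lt_min => /andP[].
have Wd x : W x -> `|quad c A q x g0 - g0| <= r / 2 / 2.
  move=> Wx; have := Hd x; rewrite sub0r normrN => H; apply/ltW/H.
  by move: Wx; rewrite /W -!ball_normE/= lt_min => /andP[].
have r2r : r / 2 < r by rewrite ltr_pdivrMr// ltr_pMr// ltr1n.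
have /choice[h hP] (x : fdnormed E0) : exists g : fdnormed F0,
    W x -> `|g - g0| <= r / 2 /\ quad c A q x g = g.
  have [Wx|nWx] := pselect (W x); last by exists 0.
  have [| |f g fr gr|g gr gE] := @ball_fixed_point _ _ (quad c A q x) g0
    (r / 2).
  - by rewrite divr_ge0// ltW.
  - exact: Wd.
  - rewrite quad_slopeP; apply: Lr; first exact: Wr.
    + exact: le_lt_trans fr _.
    + exact: le_lt_trans gr _.
  - by exists g.
have hr x : W x -> `|h x - g0| < r.
  by move=> Wx; have [hx _] := hP x Wx; exact: le_lt_trans hx _.
have Wx0 : W x0 by apply: ballxx; rewrite lt_min r0 d0.
exists W, h; split=> //.
- exact: ball_open.
- have [_ hE] := hP x0 Wx0.
  have : `|h x0 - g0| <= 2^-1 * `|h x0 - g0|.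
    rewrite -{1}hE -{1}fix0 quad_slopeP; apply: Lr; rewrite ?subrr ?normr0//.
    exact: hr.
  have := normr_ge0 (h x0 - g0); set a := `|_| => a0 a2.
  have /eqP : a = 0 by lra.
  by rewrite normr_eq0 subr_eq0 => /eqP.
- apply: (@branch_smooth _ _ _ c A q) => //.
  + exact: ball_open.
  + by move=> x /hP[].
  + by move=> x y z e Wx Wy Wz; apply: Lr; [exact: Wr|exact: hr|exact: hr].
  + exists (r + `|g0|) => x Wx; rewrite -[h x](subrK g0)
    (le_trans (ler_normD _ _))//.
    by rewrite lerD2r ltW// hr.
- by move=> x /hP[].
Qed.

(** * Alternating maps and the action of GL *)

Section AlternatingMaps.
Variables (R : realType) (V : vectType R).
Local Notation A2 := (subvs_of (alt_space V)).
Implicit Types (m s t : alt2 V) (g u w : 'End(V)).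

Lemma alt2D s t x y : (s + t : alt2 V) x y = s x y + t x y.
Proof. by rewrite /alt2_fun linearD !add_lfunE. Qed.

Lemma alt2Z a s x y : (a *: s : alt2 V) x y = a *: s x y.
Proof. by rewrite /alt2_fun linearZ !scale_lfunE. Qed.

(** Evaluation of alternating maps becomes an instance of the evaluation of
    trilinear maps through this inclusion. *)
Definition alt2_incl : 'Hom(A2, 'Hom(V, 'Hom(V, V))) := linfun vsval.

Lemma alt2_inclE s x y : alt2_incl s x y = s x y.
Proof. by rewrite lfunE. Qed.

Lemma alt2_cvg (T : Type) (F : set_system T) (FF : Filter F) (s : T -> alt2 V)
    (s0 : alt2 V) :
  (forall x y, (s t x y : fdnormed V) @[t --> F] --> (s0 x y : fdnormed V)) ->
    s @ F --> s0.
Proof.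
move=> ss.
have ii : (alt2_incl (s t) : fdnormed _) @[t --> F] -->
  (alt2_incl s0 : fdnormed _).
  apply: lfun_cvg => x; apply: lfun_cvg => y; rewrite alt2_inclE.
  under eq_cvg do rewrite alt2_inclE.
  exact: ss.
have pE (r : alt2 V) : vsproj (alt_space V) (alt2_incl r) = r.
  by rewrite lfunE/= vsvalK.
rewrite -(pE s0); under eq_cvg => t do rewrite -(pE (s t)).
apply: (@fd_linear_cvg _ _ (alt2 V) (vsproj (alt_space V))) ii.
exact: linearP.
Qed.

Definition post g s : alt2 V := mk_alt2 (fun x y => g (s x y)).

Lemma postE g s x y : post g s x y = g (s x y).
Proof.
rewrite /post mk_alt2E// => [z a v v'|z a v v'|z].
- by rewrite alt2_linearr linearP.
- by rewrite alt2_linearl linearP.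
- by rewrite alt2xx linear0.
Qed.

(** The polarization of the pullback s(u x, u y), symmetrized so as to remain
    alternating in x and y. *)
Definition pull s u w : alt2 V :=
  mk_alt2 (fun x y => 2^-1 *: (s (u x) (w y) + s (w x) (u y))).

Lemma pullE s u w x y : pull s u w x y = 2^-1 *:
    (s (u x) (w y) + s (w x) (u y)).
Proof.
rewrite /pull mk_alt2E// => [z a v v'|z a v v'|z].
- rewrite !linearP/= !(alt2_linearr s) addrACA -scalerDr.
  by rewrite [LHS]scalerDr !scalerA mulrC.
- rewrite !linearP/= !(alt2_linearl s) addrACA -scalerDr.
  by rewrite [LHS]scalerDr !scalerA mulrC.
- by rewrite [X in _ + X]alt2C subrr scaler0.
Qed.

Lemma pullxx s u x y : pull s u u x y = s (u x) (u y).
Proof.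
by rewrite pullE -mulr2n -(scaler_nat 2
  (s (u x) (u y))) scalerA mulVf ?scale1r//.
Qed.

Lemma lfun3E (A B C D : vectType R) (f : A -> B -> C -> D) :
  (forall b c, linear (fun a => f a b c)) ->
    (forall a c, linear (fun b => f a b c)) ->
  (forall a b, linear (f a b)) ->
  forall a b c, linfun (fun a => linfun (fun b => linfun (f a b))) a b c =
    f a b c.
Proof.
move=> l1 l2 l3 a b c.
have e3 a' b' : linfun (f a' b') =1 f a' b' by apply: linfunE_of_linear.
have e2 a' : linfun (fun b => linfun (f a' b)) =1 (fun b => linfun (f a' b)).
  apply: linfunE_of_linear => k v v'; apply/lfunP => z.
  by rewrite add_lfunE scale_lfunE !e3 l2.
rewrite (@linfunE_of_linear _ _ _ (fun a => linfun (fun b => linfun (f a b)))).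
  by rewrite e2 e3.
move=> k v v'; apply/lfunP => z; apply/lfunP => t.
by rewrite !(add_lfunE, scale_lfunE, e2, e3) l1.
Qed.

End AlternatingMaps.

Section Action.
Variables (R : realType) (V : vectType R).
Implicit Types (m s t : alt2 V) (g u w : 'End(V)).

Lemma GLK g : GL V g -> cancel g (g^-1)%VF.
Proof. exact: lker0_lfunK. Qed.

Lemma GLVK g : GL V g -> cancel (g^-1)%VF g.
Proof. exact: lker0_lfunVK. Qed.

Lemma GL_inv g : GL V g -> GL V (g^-1)%VF.
Proof. by move=> gg; apply/lker0P; exact: can_inj (GLVK gg). Qed.

Lemma GL_invK g : GL V g -> ((g^-1)^-1)%VF = g.
Proof.
move=> gg; apply/lfunP => x.
by rewrite -{1}(GLK gg x) (GLK (GL_inv gg)).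
Qed.

Lemma GL_comp g u : GL V g -> GL V u -> GL V (g \o u)%VF.
Proof.
move=> /lker0P gg /lker0P uu; apply/lker0P => x y.
by rewrite !comp_lfunE => /gg/uu.
Qed.

Lemma GL_comp_inv g u : GL V g -> GL V u ->
    ((g \o u)^-1)%VF = (u^-1 \o g^-1)%VF.
Proof.
move=> gg uu; apply/lfunP => x.
have {1}<- : (g \o u)%VF ((u^-1 \o g^-1)%VF x) = x.
  by rewrite !comp_lfunE GLVK// GLVK.
by rewrite (GLK (GL_comp gg uu)).
Qed.

Lemma act_comp g u m : GL V g -> GL V u -> act (g \o u)%VF m = act g (act u m).
Proof.
move=> gg uu; apply: alt2P => x y.
by rewrite !actE GL_comp_inv// !comp_lfunE.
Qed.

Lemma actVK g m : GL V g -> act g (act (g^-1)%VF m) = m.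
Proof.
move=> gg; apply: alt2P => x y.
by rewrite !actE GL_invK// !GLVK.
Qed.

Lemma actK g m : GL V g -> act (g^-1)%VF (act g m) = m.
Proof. by move=> gg; rewrite -{2}(GL_invK gg) actVK//; exact: GL_inv. Qed.

Lemma act_linear g : linear (act g).
Proof.
move=> a s t; apply: alt2P => x y; rewrite alt2D alt2Z !actE alt2D alt2Z.
by rewrite linearP.
Qed.

Lemma act_nilp k g m : GL V g -> nilp_var V k m -> nilp_var V k (act g m).
Proof.
move=> gg [mJ mN]; split=> [x y z|x].
  have := mJ ((g^-1)%VF x) ((g^-1)%VF y) ((g^-1)%VF z); rewrite /jacobiator =>
    J.
  by rewrite !actE !(GLK gg) -!(linearD g) J linear0.
have foldl_act l a : foldl (act g m) a l =
    g (foldl m ((g^-1)%VF a) (map (g^-1)%VF l)).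
  elim: l a => [|b l ih] a /=; first by rewrite GLVK.
  by rewrite ih actE GLK.
case/tupleP: x => x0 x; rewrite /Nk theadE/= foldl_act.
have := mN [tuple of (g^-1)%VF x0 :: map (g^-1)%VF x].
by rewrite /Nk theadE/= => ->; rewrite linear0.
Qed.

End Action.

(** * Nilpotent structures close to a given one *)

(** Divide f (x + t v') = t ('d f x v' + o(1)) by t. *)
Lemma diff_direction_neq0 (R : realType) (V W : normedModType R) (f : V -> W)
    (x v : V) :
  differentiable f x -> f x = 0 -> 'd f x v <> 0 ->
  \forall v' \near v & t \near (0 : R), t != 0 -> f (x + t *: v') <> 0.
Proof.
move=> df fx0 dv0; set a := `|'d f x v|.
have a0 : 0 < a by rewrite normr_gt0; apply/eqP.
have b0 : 0 < a / 2 / (`|v| + 1) by rewrite !divr_gt0// ltr_wpDl.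
have fE := diff_eps df b0.
have xtv : (fun p : V * R => x + p.2 *: p.1) @ (nbhs v, nbhs (0 : R)) --> x.
  have -> : nbhs x = nbhs (x + (0 : R) *: v) by rewrite scale0r addr0.
  apply: cvgD; first exact: cvg_cst.
  by apply: cvgZ; [exact: cvg_snd|exact: cvg_fst].
have Hv : \forall v' \near v, `|v'| < `|v| + 1.
  near=> v'; rewrite -[v'](subrK v)
    (le_lt_trans (ler_normD _ _))// addrC ltrD2l.
  by near: v'; exact: near_dist_lt.
have Hd : \forall v' \near v, a / 2 < `|'d f x v'|.
  have : `|'d f x v'| @[v' --> v] --> a.
    by apply: cvg_norm; exact: diff_continuous.
  by move=> /cvgr_gt; apply; rewrite ltr_pdivrMr// ltr_pMr// ltr1n.
have H1 : filter_prod (nbhs v) (nbhs (0 : R))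
  [set p | `|f (x + p.2 *: p.1) - f x - 'd f x (x + p.2 *: p.1 - x)|
    <= a / 2 / (`|v| + 1) * `|x + p.2 *: p.1 - x|] := xtv _ fE.
have H2 : filter_prod (nbhs v) (nbhs (0 : R)) [set p | `|p.1| < `|v| + 1]
  by exact: cvg_fst Hv.
have H3 : filter_prod (nbhs v) (nbhs (0 : R)) [set p | a / 2 < `|'d f x p.1|]
  by exact: cvg_fst Hd.
apply: filterS3 H1 H2 H3 => -[v' t]/= H1 H2 H3 t0 f0.
move: H1; rewrite f0 fx0 subr0 sub0r normrN addrAC subrr add0r linearZ !normrZ.
rewrite mulrCA ler_pM2l ?normr_gt0// leNgt => /negP; apply.
apply: le_lt_trans H3; rewrite mulrAC ler_pdivrMr ?ltr_wpDl//.
by rewrite ler_pM2l ?divr_gt0// ltW.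
Unshelve. all: by end_near. Qed.

Section Constraints.
Variables (R : realType) (V : vectType R).
Implicit Types (m s : alt2 V).

Lemma is_diff_alt2 m (u du w dw : alt2 V -> fdnormed V) :
  is_diff m u du -> is_diff m w dw ->
  is_diff m (fun s : alt2 V => s (u s) (w s) : fdnormed V)
    (fun v : alt2 V => m (u m) (dw v) + (m (du v) (w m) + v (u m) (w m))).
Proof.
move=> u' w'; have := is_diff_lfun3 (alt2_incl V) u' w'.
by congr is_diff_def; apply/funext => v; rewrite !alt2_inclE.
Qed.

(** The Jacobiator is quadratic; polarizing it at m gives the
    Chevalley-Eilenberg differential up to sign. *)
Lemma is_diff_jacobiator m x y z :
  is_diff m (fun s => jacobiator s x y z : fdnormed V)
    (fun v => - d2 m v x y z).
Proof.
have ev a b c : is_diff m (fun s : alt2 V => s (s a b) c : fdnormed V)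
    (fun v : alt2 V => m (v a b) c + v (m a b) c).
  have D0 (e : fdnormed V) := is_diff_cst (V := alt2 V) e m.
  have := is_diff_alt2 (is_diff_alt2 (D0 a) (D0 b)) (D0 c).
  congr is_diff_def; apply/funext => v; rewrite /= ?fctE !alt2x0.
  by rewrite !add0r (alt2C m 0 b) alt2x0 oppr0 add0r.
have dE (v : alt2 V) : m (v x y) z + v (m x y) z + (m (v y z) x + v (m y z) x) +
    (m (v z x) y + v (m z x) y) = - d2 m v x y z.
  have -> : v (m z x) y = - v (m x z) y.
    by rewrite (alt2C m z x) /alt2_fun linearN opp_lfunE.
  have -> : m (v z x) y = m y (v x z).
    by rewrite (alt2C m) (alt2C v z x) /alt2_fun linearN opprK.
  rewrite (alt2C m (v x y)) (alt2C m (v y z)) /d2 !opprD !opprK !addrA.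
  by rewrite [RHS](AC 6 (3*4*1*6*2*5)).
have := is_diffD (is_diffD (ev x y z) (ev y z x)) (ev z x y).
by congr is_diff_def; apply/funext => v; rewrite -dE.
Qed.

Lemma Nk_differentiable k m (x : k.+1.-tuple V) :
  differentiable (fun s => Nk s x : fdnormed V) m.
Proof.
rewrite /Nk; move: (thead x) (behead x) => a l.
suff H : forall u : alt2 V -> fdnormed V, differentiable u m ->
    differentiable (fun s => foldl s (u s) l : fdnormed V) m.
  by apply: (H (fun=> a)); exact: differentiable_cst.
elim: l => [|b l ih] u du //=.
apply: (ih (fun s : alt2 V => s (u s) b)).
have D0 := is_diff_cst (V := alt2 V) (b : fdnormed V) m.
by have [] := is_diff_alt2 (differentiableP du) D0.
Qed.

Lemma post_id m : post \1%VF m = m.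
Proof. by apply: alt2P => x y; rewrite postE id_lfunE. Qed.

Lemma post_cvg (T : Type) (F : set_system T) (FF : Filter F)
    (g : T -> fdnormed 'End(V)) (s : T -> alt2 V)
    (g0 : fdnormed 'End(V)) (s0 : alt2 V) :
  g @ F --> g0 -> s @ F --> s0 -> post (g t) (s t) @[t --> F] --> post g0 s0.
Proof.
move=> gg ss; apply: alt2_cvg => x y; rewrite postE;
  under eq_cvg do rewrite postE.
apply: cvg_lfun => //; rewrite -alt2_inclE; under eq_cvg do rewrite -alt2_inclE.
by apply: cvg_lfun3 => //; exact: cvg_cst.
Qed.

End Constraints.

Section LocalUniqueness.
Variables (R : realType) (V : vectType R).

(** Write n = m + t e with e on the unit sphere. For each e, either P e <> 0,
    or e is not a cocycle and some equation of the variety has a nonzero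
    derivative along e; in both cases n is excluded as soon as its
    direction is near e, g near 1 and t near 0. The compactness of the
    sphere makes this uniform in e. *)
Lemma nilp_var_locally_unique k (m : alt2 V)
    (P : 'End(subvs_of (alt_space V))) :
  nilp_var V k m -> (forall s : alt2 V, Z2nil k m s -> P s = 0 -> s = 0) ->
  \forall g \near (\1%VF : fdnormed 'End(V)) & n \near m,
    nilp_var V k n -> P (post g (n - m)) = 0 -> n = m.
Proof.
move=> [mJ mN] Zm.
have := @fd_sphere_compact R (subvs_of (alt_space V)).
move=> /compact_near_coveringP cov.
pose I := (R * fdnormed 'End(V))%type.
pose bad (i : I) (e : alt2 V) := i.1 != 0 -> P (post i.2 e) = 0 ->
  ~ nilp_var V k (m + i.1 *: e).
pose F : set_system I := filter_prod (nbhs (0 : R))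
  (nbhs (\1%VF : fdnormed 'End(V))).
have FF : Filter F by exact: filter_prod_filter.
have snd2 (e : alt2 V) : (fun p : alt2 V * I => p.2) @ filter_prod
  (nbhs e) F --> F.
  exact: cvg_snd.
have f1 : (fun i : I => i.1) @ F --> (0 : R) by exact: cvg_fst.
have f2 : (fun i : I => i.2) @ F --> (\1%VF : fdnormed 'End(V))
  by exact: cvg_snd.
(* An equation with a nonzero derivative along e has no zero m + t e' with e'
   near e and t near 0 but nonzero. *)
have dir (f : alt2 V -> fdnormed V) (e : alt2 V) : differentiable f m ->
  f m = 0 -> 'd f m e <> 0 ->
    (forall n, nilp_var V k n -> f n = 0) ->
    filter_prod (nbhs e) F [set p | bad p.2 p.1].
  move=> df fm0 dfe fN.
  have pr : (fun p : alt2 V * I => (p.1, p.2.1)) @ filter_prod (nbhs e) F -->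
    (nbhs e, nbhs (0 : R)).
    apply: cvg_pair; first exact: cvg_fst.
    exact: cvg_comp (snd2 e) f1.
  have H : filter_prod (nbhs e) F [set p | p.2.1 != 0 ->
    f (m + p.2.1 *: p.1) <> 0].
    exact: (pr _ (diff_direction_neq0 df fm0 dfe)).
  by apply: filterS H => -[e' [t g]] /= H t0 _ /fN; exact: H.
have {}cov : \near F, [set x : alt2 V | `|x| = 1] `<=` bad F.
  apply: (cov I F bad) => e /= e1.
  suff : filter_prod (nbhs e) F [set p | bad p.2 p.1] by [].
  have [Pe|/eqP Pe] := eqVneq (P e) 0; last first.
    have : (P (post p.2.2 p.1) : alt2 V) @[p --> filter_prod (nbhs e) F] -->
      (P e : alt2 V).
      rewrite -{2}(post_id e); apply: (cvg_lfun (A := subvs_of (alt_space V))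
        (B := subvs_of (alt_space V))); first exact: cvg_cst.
      apply: post_cvg; last exact: cvg_fst.
      exact: cvg_comp (snd2 e) f2.
    move=> /cvgr_neq0 H; have {}H := H (introN eqP Pe).
    by apply: filterS H => -[e' [t g]] /= /eqP Pe' t0.
  have : ~ Z2nil k m e.
    by move=> /Zm/(_ Pe) e0; move: e1; rewrite e0 normr0 => /esym/eqP;
      rewrite oner_eq0.
  move=> /not_andP[/existsNP[x /existsNP[y /existsNP[z dxyz]]]|/existsNP[x dx]].
    have dJ := is_diff_jacobiator m x y z.
    apply: (dir (fun s => jacobiator s x y z)) => //.
    + by rewrite diff_val => /eqP; rewrite oppr_eq0 => /eqP.
    + by move=> n [].
  apply: (dir (fun s => Nk s x)) => //; first exact: Nk_differentiable.
  by move=> n [].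
(* Polar coordinates around m: the radius is `|n - m|. *)
have tg : (fun p : fdnormed 'End(V) * alt2 V => (`|p.2 - m|, p.1)) @
    filter_prod (nbhs (\1%VF : fdnormed 'End(V))) (nbhs m) --> F.
  apply: (@cvg_pair _ _ _ _ (nbhs (0 : R)) (nbhs (\1%VF : fdnormed 'End(V))));
    last exact: cvg_fst.
  rewrite -(normr0 (alt2 V)) -(subrr m); apply: cvg_norm; apply: cvgB;
    last exact: cvg_cst.
  exact: cvg_snd.
have H : filter_prod (nbhs (\1%VF : fdnormed 'End(V))) (nbhs m)
    [set p | [set x : alt2 V | `|x| = 1] `<=` bad (`|p.2 - m|, p.1)].
  exact: (tg _ cov).
apply: filterS H => -[g n] /= sb Nn Pgn.
apply/eqP; rewrite -subr_eq0 -normr_eq0; apply: contraPT Nn => t0.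
set t := `|n - m| in t0 sb *; pose e : alt2 V := t^-1 *: (n - m).
have ne : m + t *: e = n by rewrite /e scalerA divff// scale1r addrC subrK.
rewrite -{1}ne; apply: sb => //=.
  have tge : 0 <= t by exact: normr_ge0.
  by rewrite /e normrZ normfV (ger0_norm tge) mulVf.
have -> : post g e = t^-1 *: post g (n - m).
  by apply: alt2P => x y; rewrite alt2Z !postE alt2Z linearZ.
by rewrite linearZ/= Pgn scaler0.
Qed.

End LocalUniqueness.

(** * The slice transverse to the coboundaries *)

Lemma smooth_onS (R : realType) (V W : normedModType R) (U U' : set V)
    (f : V -> W) :
  U' `<=` U -> smooth_on U f -> smooth_on U' f.
Proof.
move=> sU sf n; have {sf} := sf n.
elim: n f => [|n ih] f /= => [cf x /sU/cf//|[df cf]].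
by split=> [x /sU/df//|v]; exact: ih.
Qed.

Section Slice.
Variables (R : realType) (V : vectType R) (m : alt2 V).
Local Notation A2 := (subvs_of (alt_space V)).

Lemma d1_linear : linear (d1 m).
Proof.
move=> a f g; apply: alt2P => x y; rewrite alt2D alt2Z !d1E !add_lfunE
  !scale_lfunE.
rewrite !(alt2_linearr m) !scalerBr !opprD !addrA.
by rewrite [LHS](AC 6 (1*3*5*2*4*6)).
Qed.

Definition d1_lfun : 'Hom('End(V), A2) := linfun (d1 m : 'End(V) -> A2).

Lemma d1_lfunE f : d1_lfun f = d1 m f.
Proof. by rewrite linfunE_of_linear//; exact: d1_linear. Qed.

Definition coboundary_proj : 'End(A2) := projv (limg d1_lfun).

Lemma coboundary_proj_d1 f : coboundary_proj (d1 m f) = d1 m f.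
Proof. by rewrite -d1_lfunE projv_id// memv_img// memvf. Qed.

Definition d1_section : 'Hom(A2, 'End(V)) :=
  (d1_lfun^-1 \o coboundary_proj)%VF.

Lemma d1_sectionK s : d1 m (d1_section s) = coboundary_proj s.
Proof.
by rewrite -d1_lfunE comp_lfunE limg_lfunVK// memv_proj.
Qed.

Lemma post_linearl s : linear (post (V := V) ^~ s).
Proof.
move=> a f g; apply: alt2P => x y.
by rewrite alt2D alt2Z !postE add_lfunE scale_lfunE.
Qed.

Lemma pullC s (u w : 'End(V)) : pull s u w = pull s w u.
Proof. by apply: alt2P => x y; rewrite !pullE addrC. Qed.

Lemma pull_linear (u w : 'End(V)) : linear (fun s => pull s u w).
Proof.
move=> a s t; apply: alt2P => x y.
rewrite alt2D alt2Z !pullE !alt2D !alt2Z addrACA -scalerDr.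
by rewrite [LHS]scalerDr !scalerA mulrC.
Qed.

Lemma pull_linearr s (u : 'End(V)) : linear (pull s u).
Proof.
move=> a w w'; apply: alt2P => x y.
rewrite alt2D alt2Z !pullE !add_lfunE !scale_lfunE.
rewrite (alt2_linearr s) (alt2_linearl s) addrACA -scalerDr.
by rewrite [LHS]scalerDr !scalerA mulrC.
Qed.

Lemma pull_linearl s (w : 'End(V)) : linear (pull s ^~ w).
Proof. by move=> a u u'; rewrite !(pullC _ _ w) pull_linearr. Qed.

Definition slice_quad : 'Hom(A2, 'Hom('End(V), 'Hom('End(V), 'End(V)))) :=
  linfun (fun s : A2 => linfun (fun u =>
    linfun (fun w => - d1_section (pull s u w)))).

Lemma slice_quadE (s : alt2 V) u w :
    slice_quad s u w = - d1_section (pull s u w).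
Proof.
apply: (@lfun3E _ A2 _ _ _ (fun s u w => - d1_section (pull s u w))) =>
  [u' w'|s' w'|s' u'] a x y.
- by rewrite pull_linear linearP opprD scalerN.
- by rewrite pull_linearl linearP opprD scalerN.
- by rewrite pull_linearr linearP opprD scalerN.
Qed.

Definition slice_lin : 'End('End(V)) :=
  linfun (fun g : 'End(V) => d1_section (d1 m g + post g m)).

Lemma slice_linE g : slice_lin g = d1_section (d1 m g + post g m).
Proof.
apply: (@linfunE_of_linear _ 'End(V) 'End(V)
  (fun g => d1_section (d1 m g + post g m))).
move=> a u w; rewrite d1_linear post_linearl addrACA -scalerDr.
by rewrite linearP.
Qed.

Definition slice_cst : 'End(V) := \1%VF - d1_section (d1 m \1%VF).

(** The derivative in g, at g = 1, of the defect of (g, m) is minus d1. *)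
Lemma infinitesimal_slice (e : 'End(V)) :
    d1 m e + post e m = pull m e \1%VF + pull m \1%VF e.
Proof.
apply: alt2P => x y; rewrite !alt2D postE d1E subrK (pullC m e) pullE !id_lfunE.
rewrite -scalerDl -[2^-1]mul1r -mulrDl divff ?pnatr_eq0// scale1r.
by rewrite [in RHS](alt2C m (e x)).
Qed.

(** With K = [d1_section m], the equation h = 1 + K (d1 (h - 1) + defect) is
    quadratic in h and, by [infinitesimal_slice], its right-hand side has
    zero derivative at (m, 1). Since d1 K is the projection on the
    coboundaries, applying d1 leaves the projection of the defect. *)
Lemma slice_exists : exists (W : set (alt2 V)) (h : alt2 V -> fdnormed 'End(V)),
  [/\ open W, W m, h m = \1%VF, smooth_on W h &
      forall la, W la -> coboundary_proj
        (post (h la) m - pull la (h la) (h la)) = 0].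
Proof.
have [||W [h [oW Wm hm sh hP]]] :=
  @quadratic_implicit_function R A2 'End(V) slice_cst slice_lin slice_quad m
    \1%VF.
- rewrite /quad /slice_cst slice_linE slice_quadE.
  have -> : pull m \1%VF \1%VF = m by apply: alt2P => x y;
    rewrite pullxx !id_lfunE.
  by rewrite post_id linearD/= addrA subrK addrK.
- move=> e; rewrite quad_slopeE slice_linE !slice_quadE infinitesimal_slice.
  by rewrite (linearD d1_section)/= -addrA -opprD subrr.
exists W, h; split=> // la /hP.
set g := h la => gE.
have {}gE : d1_section (d1 m (g - \1%VF) + (post g m - pull la g g)) =
  g - \1%VF.
  have -> : d1 m (g - \1%VF) = d1 m g - d1 m \1%VF.
    by rewrite -!d1_lfunE linearB.
  rewrite addrACA addrA addrAC.
  rewrite !(linearB d1_section)/=; apply/eqP; rewrite eq_sym subr_eq -{1}gE.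
  rewrite /quad slice_linE slice_quadE /slice_cst.
  by apply/eqP; rewrite [LHS](AC 4 (3*4*2*1)).
have := congr1 (d1 m) gE; rewrite d1_sectionK linearD/= coboundary_proj_d1.
by move=> /eqP; rewrite -subr_eq0 addrAC subrr add0r => /eqP.
Qed.

End Slice.

(** * The local section and rigidity *)

(** In particular linear maps close to the identity are invertible. *)
Lemma near_id_bounded_below (R : realType) (V : vectType R) :
  nbhs (\1%VF : fdnormed 'End(V))
    [set g : fdnormed 'End(V) |
      forall e : fdnormed V, `|e| <= 2 * `|g e : fdnormed V|].
Proof.
have [C C0 HC] := lfun_bounded V V.
have C2 : 0 < (2 * C)^-1 by rewrite invr_gt0 mulr_gt0.
apply: filterS (near_dist_lt _ C2) => g g1 /=.
have -> : g = \1%VF - (\1%VF - g : 'End(V)) by rewrite opprB addrC subrK.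
apply: contraction_bounded_below => e.
rewrite (le_trans (HC _ _))// ler_wpM2r//.
by rewrite -ler_pdivlMl// -invfM mulrC distrC ltW.
Qed.

Section LocalSection.
Variables (R : realType) (V : vectType R).

Lemma pull_backE (g : 'End(V)) (la : alt2 V) x y : GL V g ->
  act (g^-1)%VF la x y = (g^-1)%VF (la (g x) (g y)).
Proof. by move=> gg; rewrite actE GL_invK. Qed.

Lemma act_inv_cvg (T : Type) (F : set_system T) (FF : Filter F)
    (g : T -> fdnormed 'End(V)) (la : T -> alt2 V) (m : alt2 V) :
  g @ F --> (\1%VF : fdnormed 'End(V)) -> la @ F --> m ->
  act ((g t)^-1)%VF (la t) @[t --> F] --> m.
Proof.
move=> gg ll; have gb : F [set t | forall e : fdnormed V,
  `|e| <= 2 * `|g t e : fdnormed V|].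
  exact: (gg _ (near_id_bounded_below V)).
have b1 : forall e : fdnormed V, `|e| <= 2 *
  `|(\1%VF : 'End(V)) e : fdnormed V|.
  by move=> e; rewrite id_lfunE ler_peMl// ler1n.
have two0 : 0 < 2 :> R by rewrite ltr0n.
have gV := lfun_inv_cvg FF two0 gb b1 gg.
have V1 z : (\1%VF : 'End(V))^-1%VF z = z.
  by rewrite -[RHS](lker0_lfunK (lker0_bounded_below b1)) id_lfunE.
apply: alt2_cvg => x y.
apply: (cvg_trans (G := (((g t)^-1)%VF (la t (g t x) (g t y)) :
  fdnormed V) @[t --> F])).
  apply: near_eq_cvg; apply: filterS gb => t gt.
  by rewrite pull_backE//; exact: lker0_bounded_below gt.
rewrite -(V1 (m x y)) -[X in _^-1%VF (m X _)](id_lfunE x) -[X in _^-1%VF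
  (m _ X)](id_lfunE y).
apply: cvg_lfun => //; rewrite -alt2_inclE; under eq_cvg do rewrite -alt2_inclE.
apply: cvg_lfun3 => //; apply: cvg_lfun => //; exact: cvg_cst.
Qed.

(** The solution h of the slice equation works: where la is in the variety, so
    is its pullback by h la, and the slice equation makes the pullback
    equal to m by [nilp_var_locally_unique]. *)
Lemma nilp_local_section k (m : alt2 V) : nilp_var V k m ->
    Z2nil k m `<=` B2 m ->
  exists (W : set (alt2 V)) (H : alt2 V -> fdnormed 'End(V)),
     [/\ open W /\ W m, forall la, W la -> GL V (H la), smooth_on W H &
         forall la, (W `&` nilp_var V k) la -> act (H la) m = la].
Proof.
move=> mN ZB; have [W0 [h [oW0 W0m hm sh hP]]] := slice_exists m.
have Zm (s : alt2 V) : Z2nil k m s -> coboundary_proj m s = 0 -> s = 0.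
  by move=> /ZB[f _ <-]; rewrite coboundary_proj_d1.
have good := nilp_var_locally_unique mN Zm.
have hc : h la @[la --> m] --> (\1%VF : fdnormed 'End(V)).
  rewrite -hm; exact: (sh 0%N m W0m).
(* Both entries tend to the point where local uniqueness holds. *)
have pc : (fun la : alt2 V => (h la, act ((h la)^-1)%VF la)) @ nbhs m -->
    (nbhs (\1%VF : fdnormed 'End(V)), nbhs m).
  by apply: cvg_pair => //; apply: act_inv_cvg.
pose S := [set la : alt2 V | [/\ W0 la,
  forall e : fdnormed V, `|e| <= 2 * `|h la e : fdnormed V| &
  nilp_var V k (act ((h la)^-1)%VF la) ->
  coboundary_proj m (post (h la) (act ((h la)^-1)%VF la - m)) = 0 ->
  act ((h la)^-1)%VF la = m]].
have Sm : nbhs m S.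
  have N1 : nbhs m W0 by exact: open_nbhs_nbhs.
  have N2 : nbhs m [set la | forall e : fdnormed V,
    `|e| <= 2 * `|h la e : fdnormed V|].
    exact: (hc _ (near_id_bounded_below V)).
  have N3 := pc _ good.
  by apply: filterS3 N1 N2 N3 => la.
have SW : S^° `<=` S by exact: interior_subset.
have hGL la : S la -> GL V (h la) by move=> [_ /lker0_bounded_below].
exists S^°, h; split.
- by split; [exact: open_interior|exact: Sm].
- by move=> la /SW; exact: hGL.
- by apply: smooth_onS sh => la /SW[].
move=> la [/SW Sla Nla]; have gg := hGL _ Sla; case: Sla => W0la _ uniq.
(* The pullback is m, so h la carries m to la. *)
rewrite -{1}(uniq _ _) ?actVK//; first by apply: act_nilp => //; exact: GL_inv.
have <- : coboundary_proj m (- (post (h la) m - pull la (h la) (h la))) = 0.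
  by rewrite linearN/= hP// oppr0.
congr (coboundary_proj _ _); apply: alt2P => x y.
by rewrite opprB alt2B pullxx !postE alt2B linearB/= pull_backE// GLVK.
Qed.

End LocalSection.

Theorem theorem2p1 (R : realType) (n k : nat) (V : vectType R)
    (dimV : \dim {:V} = n) (k_gt0 : (0 < k)%N)
    (mu : alt2 V) (mu_nil : nilp_var V k mu)
    (H2nil_mu_eq0 : H2nil k mu = [set B2 mu]) :
  (exists (W : set (alt2 V)) (H : alt2 V -> fdnormed 'End(V)),
     [/\ open W /\ W mu,
         forall la, W la -> GL V (H la),
         smooth_on W H &
         forall la, (W `&` nilp_var V k) la -> act (H la) mu = la]) /\
  rigid k mu.
Proof.
have ZB := (H2nil_eq0P k mu).1 H2nil_mu_eq0.
have [W [H [[oW Wmu] HGL sH HE]]] := nilp_local_section mu_nil ZB.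
split; first by exists W, H.
split=> //; pose U := \bigcup_(g in GL V) [set la | W (act (g^-1)%VF la)].
exists U.
  apply: bigcup_open => g gg.
  have -> : [set la | W (act (g^-1)%VF la)] = act (g^-1)%VF @^-1` W by [].
  apply: open_comp => // la _.
  apply: (@fd_linear_cvg R (subvs_of (alt_space V))
    (alt2 V) _ _ (nbhs la) _ id) => //.
  exact: act_linear.
apply/seteqP; split=> [_ [g gg <-]|la [[g gg /= Wla] Nla]].
  split; last exact: act_nilp.
  by exists g => //=; rewrite actK.
have Nla' : nilp_var V k (act (g^-1)%VF la) by apply: act_nilp => //;
  exact: GL_inv.
exists (g \o H (act (g^-1)%VF la))%VF; first by apply: GL_comp => //;
  exact: HGL.
by rewrite act_comp//; [rewrite HE// actVK|exact: HGL].
Qed.
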